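(* The projectively universal homogeneous profinite graph $\mathbb P$ has a dense $G_\delta$ set of isolated vertices; that is, the set of isolated vertices of $\mathbb P$ is a dense $G_\delta$ subset of the topological space of vertices of $\mathbb P$.
   Context: A graph is a pair $G=(V,E)$ where $E$ is a symmetric and reflexive binary relation on $V$ (every vertex has a loop). A vertex is isolated if it is adjacent to itself only (this is not topological isolation). A homomorphism is an edge-preserving map. A homomorphism $f\colon X\to Y$ is strict if for all adjacent $p,q$ in the range of $f$ there are adjacent $a,b\in X$ with $f(a)=p$, $f(b)=q$; a surjective strict homomorphism is called a quotient map. A profinite graph is a nonempty topological graph that is (simultaneously graph-isomorphic and homeomorphic to) the inverse limit of a sequence of finite (discrete) graphs with quotient maps as bonding maps, where $(x_n)$ and $(y_n)$ are adjacent in the limit iff $x_n,y_n$ are adjacent for every $n$. $\mathbb P$ denotes the unique (up to topological graph isomorphism) second countable profinite graph satisfying: given continuous quotient maps $f\colon\mathbb P\to S$ and $q\colon T\to S$, where $S,T$ are nonempty finite (discrete) graphs, there exists a continuous quotient map $g\colon\mathbb P\to T$ such that $q\circ g=f$. (Its existence and uniqueness are given by Fraïssé theory: it is the projective Fraïssé limit of nonempty finite graphs with quotient maps.) *)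

(* Defs.v *)
From mathcomp Require Import all_boot all_classical.
From mathcomp Require Import topology borel_hierarchy.

Set Implicit Arguments.
Unset Strict Implicit.
Unset Printing Implicit Defensive.

Local Open Scope classical_set_scope.

(* The library's [topologicalType]s may be empty: nonemptiness is always
   required explicitly below. *)
Record topGraph := TopGraph {
  vertex :> topologicalType;
  adj : vertex -> vertex -> Prop;
  adj_refl : forall x, adj x x;
  adj_sym : forall x y, adj x y -> adj y x
}.

Arguments adj {t} x y.
Arguments adj_refl {t} x.
Arguments adj_sym {t x y}.

Definition nonempty_graph (X : topGraph) : Prop := [set: X] !=set0.

Definition finite_discrete (X : topGraph) : Prop :=
  finite_set [set: X] /\ forall A : set X, open A.

Definition graph_hom (X Y : topGraph) (f : X -> Y) : Prop :=
  forall x y, adj x y -> adj (f x) (f y).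

Definition strict_hom (X Y : topGraph) (f : X -> Y) : Prop :=
  graph_hom f /\
  forall p q, range f p -> range f q -> adj p q ->
    exists a b, [/\ adj a b, f a = p & f b = q].

Definition quotient_map (X Y : topGraph) (f : X -> Y) : Prop :=
  strict_hom f /\ (forall y, exists x, f x = y).

Definition top_graph_iso (X Y : topGraph) (h : X -> Y) : Prop :=
  [/\ continuous h,
      exists k : Y -> X, [/\ continuous k, cancel h k & cancel k h]
    & forall x y, adj x y <-> adj (h x) (h y)].

Section InverseLimit.
Variables (X : nat -> topGraph) (f : forall n, X n.+1 -> X n).

Definition threads : set (prod_topology (fun n => vertex (X n))) :=
  [set x | forall n, @f n (x n.+1) = x n].

(* [set_type threads] carries the topology induced by the product topology. *)
Definition lim_adj (x y : set_type threads) : Prop :=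
  forall n, adj (\val x n) (\val y n).

Lemma lim_adj_refl x : lim_adj x x.
Proof. by move=> n; exact: adj_refl. Qed.

Lemma lim_adj_sym x y : lim_adj x y -> lim_adj y x.
Proof. by move=> xy n; exact: adj_sym. Qed.

Definition inverse_limit : topGraph :=
  @TopGraph (set_type threads : topologicalType) lim_adj
    lim_adj_refl lim_adj_sym.

End InverseLimit.

Definition profinite (P : topGraph) : Prop :=
  nonempty_graph P /\
  exists (X : nat -> topGraph) (f : forall n, X n.+1 -> X n),
    [/\ forall n, finite_discrete (X n),
        forall n, quotient_map (@f n)
      & exists h : P -> inverse_limit f, top_graph_iso h].

Definition proj_extension_property (P : topGraph) : Prop :=
  forall (S T : topGraph) (f : P -> S) (q : T -> S),
    finite_discrete S -> nonempty_graph S ->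
    finite_discrete T -> nonempty_graph T ->
    continuous f -> quotient_map f -> quotient_map q ->
    exists g : P -> T, [/\ continuous g, quotient_map g & q \o g = f].

(* The properties that determine the projectively universal homogeneous
   profinite graph up to isomorphism of topological graphs. Universality is
   the case where [S] is a single vertex. *)
Definition proj_universal_homogeneous (P : topGraph) : Prop :=
  [/\ @second_countable P, profinite P & proj_extension_property P].

Definition isolated_vertices (P : topGraph) : set P :=
  [set x | forall y, adj x y -> y = x].

Arguments isolated_vertices P : clear implicits.

(* Main.v *)
Require Import Defs.
From mathcomp Require Import all_boot all_classical topology borel_hierarchy.

(* Write [P] as the limit of finite graphs [X n] with projections [pi n].

   Density: apply the extension property to [pi n : P -> X n] and to the graph
   obtained from [X n] by adding an isolated vertex, collapsed onto a vertex
   [v]. The preimage of the new vertex is a nonempty clopen union of components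
   contained in the fiber of [v]. Hence every fiber of a projection contains a
   fiber of a later projection none of whose edges leaves the former one.
   Iterating yields shrinking nested fibers whose common point is isolated.

   G-delta: [x] is isolated iff for every [n] some [m] forces every vertex
   adjacent to [x] at level [m] to agree with [x] at level [n]; for fixed [n]
   this is an open condition on [x]. If it failed for all [m], the bad vertices
   would converge along an ultrafilter to a neighbor of [x] other than [x]. *)

Set Implicit Arguments.
Unset Strict Implicit.
Unset Printing Implicit Defensive.

Local Open Scope classical_set_scope.

(** By compactness the image ultrafilter has a cluster point [v]; as [[set v]] is open, the
    complement of its fiber cannot belong to [F]. *)
Lemma ultrafilter_finite_fiber (I : Type) (F : set_system I)
    (X : topGraph) (c : I -> X) :
  UltraFilter F -> finite_discrete X -> exists v, F (c @^-1` [set v]).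
Proof.
move=> FU [Xfin Xopen].
have [v [_ clv]] := finite_compact Xfin (F := c @ F) (fmap_proper_filter c _) filterT.
exists v.
have [//|Fn] := in_ultra_setVsetC (c @^-1` [set v]) FU.
have vn : nbhs v [set v] by apply: open_nbhs_nbhs; split.
by have [w []] := clv (~` [set v]) [set v] Fn vn.
Qed.

(** Strictness lifts an edge one level at a time, choosing both endpoints together. *)
Lemma adj_threads_from0 (X : nat -> topGraph) (f : forall n, X n.+1 -> X n) :
  (forall n, quotient_map (@f n)) -> forall a b : X 0, adj a b ->
  exists s t : forall n, X n,
    [/\ forall n, f n (s n.+1) = s n, forall n, f n (t n.+1) = t n,
        forall n, adj (s n) (t n), s 0 = a & t 0 = b].
Proof.
move=> fq a b ab.
have lift n (p : {p : X n * X n | adj p.1 p.2}) :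
    {q : {q : X n.+1 * X n.+1 | adj q.1 q.2} |
      f n (sval q).1 = (sval p).1 /\ f n (sval q).2 = (sval p).2}.
  case: p => -[u v] /= uv; apply: cid.
  have [[_ fs] fsurj] := fq n.
  have ru w : range (f n) w by have [z <-] := fsurj w; exists z.
  have [c [d [cd fc fd]]] := fs _ _ (ru u) (ru v) uv.
  by exists (exist _ (c, d) cd).
pose w := fix w n : {p : X n * X n | adj p.1 p.2} :=
  if n is m.+1 then sval (lift m (w m)) else exist _ (a, b) ab.
exists (fun n => (sval (w n)).1), (fun n => (sval (w n)).2).
split=> // n.
- by have [] := svalP (lift n (w n)).
- by have [] := svalP (lift n (w n)).
- exact: svalP (w n).
Qed.

(* The induction on [n] shifts the sequence, so that no casts between levels
   are needed. *)
Lemma adj_threads_through (n : nat) (X : nat -> topGraph)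
    (f : forall n, X n.+1 -> X n) :
  (forall n, quotient_map (@f n)) -> forall a b : X n, adj a b ->
  exists s t : forall n, X n,
    [/\ forall n, f n (s n.+1) = s n, forall n, f n (t n.+1) = t n,
        forall n, adj (s n) (t n), s n = a & t n = b].
Proof.
elim: n X f => [|n IHn] X f fq a b ab; first exact: adj_threads_from0.
have [s [t [fs ft st sa tb]]] :=
  IHn (fun m => X m.+1) (fun m => f m.+1) (fun m => fq m.+1) a b ab.
pose cons u : forall m, X m := fun m =>
  if m is m'.+1 as m0 return X m0 then u m' else f 0 (u 0).
exists (cons s), (cons t); split=> // -[|m] //=.
by have [[fhom _] _] := fq 0; exact: fhom.
Qed.

(** What is retained of the presentation of [P] as an inverse limit, phrased on [P] itself so that
    the main arguments avoid the subtype of threads. *)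
Record limit_cone (P : topGraph) (X : nat -> topGraph)
    (pi : forall n, P -> X n) (f : forall n, X n.+1 -> X n) : Prop :=
  LimitCone {
  cone_finite : forall n, finite_discrete (X n);
  cone_continuous : forall n, continuous (pi n);
  cone_quotient : forall n, quotient_map (pi n);
  cone_compat : forall n x, f n (pi n.+1 x) = pi n x;
  cone_adj : forall x y, (forall n, adj (pi n x) (pi n y)) -> adj x y;
  cone_inj : forall x y, (forall n, pi n x = pi n y) -> x = y;
  cone_thread : forall t : (forall n, X n),
    (forall n, f n (t n.+1) = t n) -> exists x, forall n, pi n x = t n;
  cone_base : forall (U : set P) x, open U -> U x ->
    exists n, forall y, pi n y = pi n x -> U y
}.

Lemma cone_eq_le (P : topGraph) (X : nat -> topGraph)
    (pi : forall n, P -> X n) (f : forall n, X n.+1 -> X n) :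
  (forall n x, f n (pi n.+1 x) = pi n x) ->
  forall n m x y, n <= m -> pi m x = pi m y -> pi n x = pi n y.
Proof.
move=> fpi n m x y /subnK <-; elim: (m - n) => // k IHk.
by rewrite addSn => e; apply: IHk; rewrite -(fpi _ x) -(fpi _ y) e.
Qed.

Lemma inverse_limit_cvg (X : nat -> topGraph) (f : forall n, X n.+1 -> X n)
    (F : set_system (inverse_limit f)) (x : inverse_limit f) : Filter F ->
  (forall n, F [set y | \val y n = \val x n]) -> F --> x.
Proof.
move=> FF Fx.
have cx : (\val : inverse_limit f -> prod_topology (fun n => vertex (X n))) @ F
    --> (\val x : prod_topology (fun n => vertex (X n))).
  apply/cvg_sup => n A [_ [[B oB <-] Bx sBA]].
  apply: (filterS (F := F) _ (Fx n)) => y /= yx; apply: sBA => /=.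
  by move: Bx; rewrite /= -yx.
move=> A [_ [[B oB <-] Bx sBA]].
have /cx FB : nbhs (\val x : prod_topology (fun n => vertex (X n))) B.
  exact: open_nbhs_nbhs.
by apply: (filterS (F := F) _ FB) => y; exact: sBA.
Qed.

Lemma profinite_limit_cone (P : topGraph) : profinite P ->
  exists X f pi, @limit_cone P X pi f.
Proof.
move=> [_ [X [f [Xfin fq [h [hc [k [kc hk kh]] hadj]]]]]].
exists X, f, (fun n x => \val (h x) n).
have thr t : (forall n, f n (t n.+1) = t n) ->
    exists x, forall n, \val (h x) n = t n.
  move=> ft; have tT : t \in threads f by rewrite inE.
  by exists (k (exist _ t tT)) => n; rewrite kh.
have val_thr (z : inverse_limit f) n : f n (\val z n.+1) = \val z n.
  by have /set_mem := valP z; exact.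
split=> //.
- move=> n x.
  apply: (@continuous_comp _ _ _ h (fun z : inverse_limit f => \val z n)).
    exact: hc.
  apply: (@continuous_comp (inverse_limit f)
    (prod_topology (fun n => vertex (X n))) (X n) \val (fun t => t n)).
    exact: initial_continuous.
  exact: (@proj_continuous nat (fun n => vertex (X n)) n).
- move=> n; split; first split.
  + by move=> x y /hadj; exact.
  + move=> a b _ _ /(adj_threads_through fq) [s [t [fs ft st sa tb]]].
    have [x hx] := thr s fs; have [y hy] := thr t ft.
    exists x, y; split; rewrite ?hx ?hy //.
    by apply/hadj => m; rewrite hx hy.
  + move=> a.
    have [s [_ [fs _ _ sa _]]] := adj_threads_through fq (adj_refl a).
    by have [x hx] := thr s fs; exists x; rewrite hx.
- by move=> x y xy; apply/hadj.
- move=> x y xy; apply: (can_inj hk); apply: val_inj.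
  exact: functional_extensionality_dep.
(* Otherwise some [y n] outside [U] agrees with [x] at level [n]; these points converge to [x],
   which is absurd for open [U]. *)
- move=> U x oU Ux; apply: contrapT => /forallNP nU.
  have {}nU n : {y | \val (h y) n = \val (h x) n /\ ~ U y}.
    by apply: cid; have /existsNP [y /not_implyP] := nU n; exists y.
  pose y n := sval (nU n).
  have hy : (h \o y) @ \oo --> h x.
    apply: inverse_limit_cvg => n; exists n => // m /= nm.
    apply: (@cone_eq_le P X (fun n x => \val (h x) n) f _ _ _ _ _ nm) => //.
    by have [] := svalP (nU m).
  have : y @ \oo --> x.
    have -> : y = k \o (h \o y) by apply: funext => n /=; rewrite hk.
    by rewrite -[x]hk; exact: cvg_comp hy (kc (h x)).
  move=> /(_ U (open_nbhs_nbhs (conj oU Ux))) [n _ /(_ n (leqnn n))].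
  by have [] := svalP (nU n).
Qed.

Section AddVertex.
Variable S : topGraph.

Definition add_vertex_adj (u v : discrete_topology (option S)) : Prop :=
  match u, v with
  | Some a, Some b => adj a b
  | None, None => True
  | _, _ => False
  end.

Lemma add_vertex_adj_refl u : add_vertex_adj u u.
Proof. by case: u => //= a; exact: adj_refl. Qed.

Lemma add_vertex_adj_sym u v : add_vertex_adj u v -> add_vertex_adj v u.
Proof. by case: u v => [a|] [b|] //=; exact: adj_sym. Qed.

Definition add_vertex : topGraph :=
  @TopGraph (discrete_topology (option S)) add_vertex_adj
    add_vertex_adj_refl add_vertex_adj_sym.

Lemma add_vertex_finite_discrete : finite_discrete S ->
  finite_discrete add_vertex.
Proof.
move=> [Sfin _]; split; last by move=> A; exact: discrete_open.
have -> : [set: option S] = [set None] `|` Some @` [set: S].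
  by apply/seteqP; split=> // -[a|] _; [right; exists a|left].
by rewrite finite_setU; split; [exact: finite_set1|exact: finite_image].
Qed.

Lemma add_vertex_collapse_quotient (v : S) :
  @quotient_map add_vertex S (fun u => odflt v u).
Proof.
split; last by move=> a; exists (Some a).
split; last by move=> a b _ _ ab; exists (Some a), (Some b).
by move=> [a|] [b|] //= _; exact: adj_refl.
Qed.

End AddVertex.

Lemma fiber_contains_open_component (P S : topGraph) (f : P -> S) (x : P) :
  proj_extension_property P -> finite_discrete S ->
  continuous f -> quotient_map f ->
  exists W : set P, [/\ open W, W !=set0, forall y, W y -> f y = f x
    & forall y z, W y -> adj y z -> W z].
Proof.
move=> ext Sfin fc fq.
have [||g [gc [[ghom _] gsurj] qg]] := ext S (add_vertex S) f
    (fun u => odflt (f x) u) Sfin _ (add_vertex_finite_discrete Sfin) _ fc fq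
    (add_vertex_collapse_quotient (f x)).
- by exists (f x).
- by exists None.
(* This set lies in the fiber of [x] because the collapse sends [None] to [f x], and is closed under
   adjacency because [None] is isolated. *)
exists (g @^-1` [set None]); split.
- have /continuousP := gc; apply.
  exact: (add_vertex_finite_discrete Sfin).2.
- by have [y gy] := gsurj None; exists y.
- by move=> y /= gy; have := congr1 (@^~ y) qg; rewrite /= gy.
- by move=> y z /= gy /ghom; rewrite gy; case: (g z).
Qed.

Section Isolated.
Variables (P : topGraph) (X : nat -> topGraph) (pi : forall n, P -> X n)
  (f : forall n, X n.+1 -> X n).
Hypothesis cone : limit_cone pi f.

Lemma dense_isolated_vertices : proj_extension_property P ->
  dense (isolated_vertices P).
Proof.
move=> ext U [x0 Ux0] oU.
have [n0 n0U] := cone_base cone oU Ux0.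
(* A pair [(n, x)] stands for the fiber of [pi n] through [x]. Loops make the second clause imply
   that the fiber of [b] lies in that of [a]. *)
pose R (a b : nat * P) := a.1 < b.1 /\
  forall y z, pi b.1 y = pi b.1 b.2 -> adj y z -> pi a.1 z = pi a.1 a.2.
have step a : {b | R a b}.
  apply: cid; case: a => n x.
  have [W [oW [y Wy] Wx Wadj]] := fiber_contains_open_component x ext
    (cone_finite cone n) (@cone_continuous _ _ _ _ cone n)
    (cone_quotient cone n).
  have [m mW] := cone_base cone oW Wy.
  (* [n.+1] makes the level grow strictly, and [m] keeps the new fiber inside [W]. *)
  exists (maxn n.+1 m, y); split=> /=; first by rewrite leq_maxl.
  move=> z w zy zw; apply: Wx; apply: (Wadj z) => //; apply: mW.
  by apply: (cone_eq_le (cone_compat cone)) zy; rewrite leq_maxr.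
have [s [s0 sR]] := dependent_choice step (n0, x0).
have sk k : k <= (s k).1.
  by elim: k => // k IHk; have [lt _] := sR k; exact: leq_ltn_trans lt.
have nested k d y : pi (s (k + d)).1 y = pi (s (k + d)).1 (s (k + d)).2 ->
    pi (s k).1 y = pi (s k).1 (s k).2.
  elim: d => [|d IHd]; rewrite ?addn0 // addnS => e.
  by apply: IHd; have [_ /(_ y y e (adj_refl y))] := sR (k + d).
(* The point [(s k.+1).2] lies in the fiber [s k], of level at least [k], so these values form a
   thread. *)
have [|x xs] := cone_thread cone (t := fun k => pi k (s k).2).
  move=> k; rewrite (cone_compat cone).
  apply: (cone_eq_le (cone_compat cone)) (sk k) _.
  by apply: (nested k 1); rewrite addn1.
have xcell k : pi (s k).1 x = pi (s k).1 (s k).2.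
  by rewrite xs; apply: (nested k ((s k).1 - k)); rewrite subnKC.
exists x; split; first by apply: n0U; have := xcell 0; rewrite s0.
(* Since [x] lies in the fiber [s k.+1], its neighbors lie in the fiber [s k] and so agree with [x]
   at level [k]. *)
move=> y xy; apply: (cone_inj cone) => k.
apply: (cone_eq_le (cone_compat cone)) (sk k) _.
by have [_ /(_ x y (xcell k.+1) xy) ->] := sR k; rewrite xcell.
Qed.

Let controlled n : set P :=
  [set x | exists m, forall y, adj (pi m x) (pi m y) -> pi n y = pi n x].

(** For a fixed witness [m], the condition involves [x] only through [pi m x] and [pi n x], hence is
    constant on an intersection of two open fibers. *)
Let open_controlled n : open (controlled n).
Proof.
rewrite openE => x [m xm].
have fiber k : nbhs x [set y | pi k y = pi k x].
  apply: (@cone_continuous _ _ _ _ cone k x [set pi k x]).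
  by apply: open_nbhs_nbhs; split=> //; exact: (cone_finite cone k).2.
apply: filterS2 (fiber m) (fiber n) => y /= ym yn.
by exists m => z; rewrite ym yn; exact: xm.
Qed.

Let isolated_controlled n : isolated_vertices P `<=` controlled n.
Proof.
move=> x xiso; apply: contrapT => /forallNP nx.
have {}nx m : {y | adj (pi m x) (pi m y) /\ pi n y <> pi n x}.
  by apply: cid; have /existsNP [y /not_implyP] := nx m; exists y.
pose y m := sval (nx m).
have [F [FU Foo]] := ultraFilterLemma (F := \oo) _.
have v k := cid (ultrafilter_finite_fiber
  (fun m => pi k (y m)) FU (cone_finite cone k)).
(* Coordinate [k] of [z] is the value of [pi k (y m)] for [F]-almost all [m]; two sets of [F] meet,
   which gives compatibility. *)
have [|z zv] := cone_thread cone (t := fun k => sval (v k)).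
  move=> k; have [m [<- <-]] :=
    filter_ex (filterI (svalP (v k.+1)) (svalP (v k))).
  exact: cone_compat.
have zx : adj x z.
  apply: (cone_adj cone) => k; rewrite zv.
  have Fk : F [set m | k <= m] by apply: Foo; exists k.
  have [m [/= <- km]] := filter_ex (filterI (svalP (v k)) Fk).
  have [a _] := svalP (nx m).
  (* An edge at level [m] comes from one in [P], whose image at level [k <= m] is again an edge. *)
  have [[_ strict] surj] := cone_quotient cone m.
  have rpi u : range (pi m) u by have [p <-] := surj u; exists p.
  have [p [q [pq px qy]]] := strict _ _ (rpi _) (rpi _) a.
  have [[pihom _] _] := cone_quotient cone k.
  have le_eq := cone_eq_le (cone_compat cone) km.
  by rewrite -(le_eq _ _ px) -(le_eq _ _ qy); exact: pihom.
have [m /= ym] := filter_ex (svalP (v n)).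
by have [_] := svalP (nx m); apply; rewrite -/(y m) ym -zv (xiso z zx).
Qed.

Lemma Gdelta_isolated_vertices : Gdelta (isolated_vertices P).
Proof.
exists controlled => //; apply/seteqP; split=> [x xiso n _|x xc y xy].
  exact: isolated_controlled.
apply: (cone_inj cone) => n; have [m] := xc n I; apply.
by have [[pihom _] _] := cone_quotient cone m; exact: pihom.
Qed.

End Isolated.

Theorem theorem3p4 (P : topGraph) (hP : proj_universal_homogeneous P) :
  dense (isolated_vertices P) /\ Gdelta (isolated_vertices P).
Proof.
have [_ /profinite_limit_cone [X [f [pi cone]]] ext] := hP.
split; first exact: dense_isolated_vertices cone ext.
exact: Gdelta_isolated_vertices cone.
Qed.
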